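(* Let $(\bar p,\bar x)\in\mathbb{P}\times\mathbb{X}$, with $\bar x\in\mathcal{S}(\bar p)$. Suppose that $F$ admits an inner prederivative $H_F((\bar p,\bar x);\cdot):\mathbb{P}\times\mathbb{X}\rightrightarrows\mathbb{Y}$ at $(\bar p,\bar x)$, which is l.s.c. on $\mathbb{P}\times\mathbb{X}$. Then $$\mathrm{D}\mathcal{S}(\bar p,\bar x)(p)\subseteq \bigcap_{y\in F(\bar p,\bar x)}\{v\in\mathbb{X}\ |\ H_F((\bar p,\bar x);(p,v))\subseteq \mathrm{T}(C;y)\},\qquad\forall p\in\mathbb{P}.$$
   Context: Standing assumptions: $(\mathbb{P},\|\cdot\|)$ and $(\mathbb{Y},\|\cdot\|)$ are normed vector spaces, $(\mathbb{X},\|\cdot\|)$ is a Banach space, $\mathbb{P}\times\mathbb{X}$ carries the max-norm, $C\subset\mathbb{Y}$ is a closed convex cone with $\mathrm{int}\,C\ne\varnothing$, and $F:\mathbb{P}\times\mathbb{X}\rightrightarrows\mathbb{Y}$ is a set-valued mapping with nonempty values everywhere. The solution mapping $\mathcal{S}:\mathbb{P}\rightrightarrows\mathbb{X}$ of the parameterized set-valued inclusion $F(p,x)\subseteq C$ is $\mathcal{S}(p)=\{x\in\mathbb{X}\ |\ F(p,x)\subseteq C\}$; $\mathrm{graph}\,\mathcal{S}=\{(p,x)\ |\ x\in\mathcal{S}(p)\}$. $\mathrm{B}(x,r)$ is the closed ball with center $x$ and radius $r$ and $\mathbb{B}$ is the closed unit ball. A set-valued mapping $\Phi$ is l.s.c.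 at $x_0$ if for every open $V$ with $\Phi(x_0)\cap V\ne\varnothing$ there is a neighbourhood $U$ of $x_0$ with $\Phi(x)\cap V\neq\varnothing$ for all $x\in U$. A set-valued mapping $H$ is positively homogeneous if $H(tx)=tH(x)$ for all $t>0$. A positively homogeneous mapping $H_\Phi(x_0;\cdot):\mathbb{V}\rightrightarrows\mathbb{Y}$ is an inner prederivative of $\Phi:\mathbb{V}\rightrightarrows\mathbb{Y}$ ($\mathbb{V}$ a normed space) at $x_0$ if for every $\epsilon>0$ there is $\delta>0$ such that $\Phi(x_0)+H_\Phi(x_0;x-x_0)\subseteq\Phi(x)+\epsilon\|x-x_0\|\mathbb{B}$ for all $x\in \mathrm{B}(x_0,\delta)$. The contingent cone to a set $S$ at $y\in S$ is $\mathrm{T}(S;y)=\{v\ |\ \liminf_{t\downarrow0}\mathrm{dist}(y+tv,S)/t=0\}$, where $\mathrm{dist}(x,S)=\inf_{z\in S}\|x-z\|$. The graphical (contingent) derivative of $\mathcal{S}$ at $(\bar p,\bar x)\in\mathrm{graph}\,\mathcal{S}$ is the set-valued mapping $\mathrm{D}\mathcal{S}(\bar p,\bar x):\mathbb{P}\rightrightarrows\mathbb{X}$ with $\mathrm{graph}\,\mathrm{D}\mathcal{S}(\bar p,\bar x)=\mathrm{T}(\mathrm{graph}\,\mathcal{S};(\bar p,\bar x))$; equivalently, $v\in\mathrm{D}\mathcal{S}(\bar p,\bar x)(p)$ iff there are sequences $p_n\to p$, $v_n\to v$, $t_n\downarrow0$ ($t_n>0$) with $\bar x+t_nv_n\in\mathcal{S}(\bar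 p+t_np_n)$ for all $n\in\mathbb{N}$. *)

(* Defs.v *)
From HB Require Import structures.
From mathcomp Require Import all_boot all_order all_algebra.
From mathcomp Require Import all_classical all_reals all_analysis.
Set Implicit Arguments.
Unset Strict Implicit.
Unset Printing Implicit Defensive.
Import Order.TTheory GRing.Theory Num.Theory.
Import numFieldNormedType.Exports.
Local Open Scope classical_set_scope.
Local Open Scope ring_scope.

(** A set-valued mapping [U => V] is a function [U -> set V]. *)

Definition graph (U V : Type) (Phi : U -> set V) : set (U * V) :=
  [set z | Phi z.1 z.2].

(** Pointwise operations on sets, [A + B] and [t A]. *)
Definition set_sum (V : zmodType) (A B : set V) : set V :=
  [set a + b | a in A & b in B].

Definition set_scale (R : pzRingType) (V : lmodType R) (t : R) (A : set V) :
  set V := [set t *: a | a in A].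

(** The factor [t] is positive rather than nonnegative; for a nonempty closed
    set the two conventions agree. *)
Definition convex_cone (R : realType) (V : normedModType R) (C : set V) :=
  convex_set C /\ forall (t : R) (c : V), 0 < t -> C c -> C (t *: c).

Definition lsc_at (U V : topologicalType) (Phi : U -> set V) (x0 : U) :=
  forall W : set V, open W -> Phi x0 `&` W !=set0 ->
    \forall x \near x0, Phi x `&` W !=set0.

Definition positively_homogeneous (R : realType) (U V : normedModType R)
    (H : U -> set V) :=
  forall (t : R) (x : U), 0 < t -> H (t *: x) = set_scale t (H x).

Definition inner_prederivative (R : realType) (U V : normedModType R)
    (Phi : U -> set V) (x0 : U) (H : U -> set V) :=
  positively_homogeneous H /\
  forall eps : R, 0 < eps -> exists2 delta : R, 0 < delta &
    forall x : U, closed_ball_ Num.norm x0 delta x ->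
      set_sum (Phi x0) (H (x - x0)) `<=`
      set_sum (Phi x)
        (set_scale (eps * `|x - x0|) (closed_ball_ Num.norm (0 : V) 1)).

(** [edist_inf S x] is the distance from [x] to [S]. It is built from the
    pseudometric balls; on a normed space it is the infimum of the norms. *)
Lemma edist_inf_normE (R : realType) (V : normedModType R) (S : set V) (x : V) :
  edist_inf S x = ereal_inf [set `|x - z|%:E | z in S].
Proof.
congr ereal_inf; apply: eq_imagel => z _.
apply/eqP; rewrite eq_le; apply/andP; split.
  apply/lee_addgt0Pr => e e0; rewrite -EFinD; apply: ereal_inf_lbound.
  exists (`|x - z| + e) => //=; split; first by rewrite ltr_wpDl.
  by rewrite -ball_normE /= ltrDl.
apply: le_ereal_inf_tmp => _ [r /= [_ +] <-].
by rewrite -ball_normE /= lee_fin => /ltW.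
Qed.

(** Meaningful when [y] lies in [S]. *)
Definition contingent_cone (R : realType) (V : normedModType R)
    (S : set V) (y : V) : set V :=
  [set v | limf_einf (fun t : R => edist_inf S (y + t *: v)%R * (t^-1)%:E)%E 0^'+
           = 0%E].

(** The graph of the derivative is the contingent cone to the graph of [S];
    the library's norm on [P * X] is the max-norm. *)
Definition graphical_derivative (R : realType) (P X : normedModType R)
    (S : P -> set X) (z : P * X) : P -> set X :=
  fun p => [set v | contingent_cone (graph S) z (p, v)].

Definition solution_map (P X Y : Type) (F : P * X -> set Y) (C : set Y) :
  P -> set X := fun p => [set x | F (p, x) `<=` C].

(* Main.v *)
Require Import Defs.
From HB Require Import structures.
From mathcomp Require Import all_boot all_order all_algebra.
From mathcomp Require Import all_classical all_reals all_analysis.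
Import Order.TTheory GRing.Theory Num.Theory.
Import numFieldNormedType.Exports.
Local Open Scope classical_set_scope.
Local Open Scope ring_scope.

(** The graph of the derivative and the upper bound are both given by
    contingent cones, and a vector [v] belongs to the contingent cone to [S] at
    [y] exactly when arbitrarily small steps
    [t > 0] admit directions [u] arbitrarily close to [v] with [y + t u] in [S]
    ([contingent_coneP]); this is the description by sequences, without the
    sequences.

    Take [v] in the graphical derivative at [p], a point [y] of
    [F (pbar, xbar)] and [w] in [H (p, v)]. There are small [t > 0] and
    directions [u] close to [(p, v)] such that [F] sends
    [(pbar, xbar) + t u] into [C]. Lower semicontinuity of [H] at [(p, v)]
    gives [w'] in [H u] close to [w], and by positive homogeneity [t w'] lies
    in [H (t u)]. The inner prederivative then puts [y + t w'] within
    [eps t |u|] of a point of [F ((pbar, xbar) + t u)], hence of [C]. Writing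
    that point as [y + t u'], the direction [u'] is within [eps |u|] of [w'].
    Since [|u|] stays bounded by [|(p, v)| + 1], [u'] is as close to [w] as
    desired, so [w] is in the contingent cone to [C] at [y]. *)

(** Nonnegativity near the limit already bounds the lower limit below by 0, so
    only the upper bound has content. *)
Lemma limf_einf_eq0P (R : realType) (T : choiceType) (X : filteredType T)
    (f : X -> \bar R) (F : set_system X) (FF : Filter F) :
  (\forall x \near F, (0 <= f x)%E) ->
  limf_einf f F = 0%E <->
  forall (e : R) (V : set X), 0 < e -> F V ->
    exists2 x, V x & (f x < e%:E)%E.
Proof.
move=> f0; rewrite limf_einfE; split=> [f_lim e V e0 FV|f_small].
- have: (ereal_inf (f @` V) < e%:E)%E.
    apply: le_lt_trans (_ : 0 < e%:E)%E; last by rewrite lte_fin.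
    by rewrite -f_lim; apply: ereal_sup_ubound; exists V.
  by move=> /ereal_inf_lt[_ [x Vx <-] fx]; exists x.
- apply/eqP; rewrite eq_le; apply/andP; split.
  + apply: ge_ereal_sup => _ [V FV <-].
    apply/lee_addgt0Pr => e e0; rewrite add0e.
    have [x Vx fx] := f_small e V e0 FV.
    by apply: le_trans (ltW fx); apply: ereal_inf_lbound; exists x.
  + apply: (@le_trans _ _ (ereal_inf (f @` [set x | 0 <= f x]%E))).
      by apply: le_ereal_inf_tmp => _ [x fx <-].
    by apply: ereal_sup_ubound; exists [set x | 0 <= f x]%E.
Qed.

(** A point [z] of [S] near [y + t v] is [y + t u] for [u := t^-1 (z - y)], so
    that [dist (y + t v, S) / t < e] says that some such [u] is within [e] of
    [v]. *)
Lemma contingent_coneP (R : realType) (V : normedModType R) (S : set V)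
    (y v : V) :
  contingent_cone S y v <->
  forall e tau : R, 0 < e -> 0 < tau ->
    exists t u, [/\ 0 < t, t < tau, `|v - u| < e & S (y + t *: u)].
Proof.
rewrite /contingent_cone /= limf_einf_eq0P; last first.
  near=> t; rewrite mule_ge0 ?edist_inf_ge0 // lee_fin invr_ge0.
  by near: t; apply: nbhs_right_ge.
have dist_lt (e t : R) : 0 < t ->
    ((edist_inf S (y + t *: v)%R * (t^-1)%:E < e%:E)%E <->
     exists2 u, `|v - u| < e & S (y + t *: u)).
  move=> t0; have tN0 : t != 0 by rewrite gt_eqF.
  rewrite lte_pdivrMr // -EFinM edist_inf_normE.
  have normE u : `|y + t *: v - (y + t *: u)| = `|v - u| * t.
    by rewrite opprD addrACA subrr add0r -scalerBr normrZ gtr0_norm // mulrC.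
  split=> [/ereal_inf_lt[_ [z Sz <-]]|[u vu Su]].
  - have zE : z = y + t *: (t^-1 *: (z - y)).
      by rewrite scalerA divff // scale1r subrKC.
    rewrite lte_fin {1}zE normE ltr_pM2r // => vu.
    by exists (t^-1 *: (z - y)) => //; rewrite -zE.
  - apply: le_lt_trans (_ : (`|v - u| * t)%:E < _)%E.
      by apply: ereal_inf_lbound; exists (y + t *: u); rewrite // normE.
    by rewrite lte_fin ltr_pM2r.
split=> [v_cone e tau e0 tau0|v_dir e W e0 W0].
- have [|t [t0 t_tau] /(dist_lt _ _ t0)[u vu Su]] :=
    v_cone e [set t | 0 < t /\ t < tau] e0.
    by near=> t; split; near: t; [exact: nbhs_right_gt|exact: nbhs_right_lt].
  by exists t, u.
- have /nbhs_right0P[tau /= tau0 W_tau] := W0.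
  have [t [u [t0 t_tau vu Su]]] := v_dir e tau e0 tau0.
  exists t; last by apply/dist_lt => //; exists u.
  by rewrite -[t]add0r; apply: W_tau; rewrite /= ?sub0r ?normrN ?gtr0_norm.
Unshelve. all: by end_near. Qed.

Theorem theorem4p11 (R : realType) (P Y : normedModType R)
    (X : completeNormedModType R)
    (C : set Y) (C_closed : closed C) (C_cone : convex_cone C)
    (C_int : interior C !=set0)
    (F : P * X -> set Y) (F_nonempty : forall z, F z !=set0)
    (pbar : P) (xbar : X) (xbar_sol : solution_map F C pbar xbar)
    (H : P * X -> set Y)
    (H_prederivative : inner_prederivative F (pbar, xbar) H)
    (H_lsc : forall z, lsc_at H z) :
  forall p : P,
    graphical_derivative (solution_map F C) (pbar, xbar) p `<=`
    \bigcap_(y in F (pbar, xbar))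
      [set v | H (p, v) `<=` contingent_cone C y].
Proof.
move=> p v /contingent_coneP v_dir y Fy w Hw.
apply/contingent_coneP => e tau e0 tau0.
have e20 : 0 < e / 2 by rewrite divr_gt0.
have [H_homo H_pre] := H_prederivative.
have [r r0 H_near] : exists2 r : R, 0 < r &
    forall u, `|(p, v) - u| < r -> exists2 w', H u w' & `|w - w'| < e / 2.
  have [||r /= r0 r_ball] := (iffLR (nbhs_ballP _ _))
    (H_lsc (p, v) (ball w (e / 2)) _ _).
  - exact: ball_open.
  - by exists w; split=> //; exact: ballxx.
  exists r => // u; rewrite -ball_normE in r_ball => /r_ball[w' [Hw' ww']].
  by exists w' => //; move: ww'; rewrite -ball_normE.
pose K := `|(p, v)| + 1.
have K0 : 0 < K by rewrite ltr_wpDl.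
(* The error is [eps |u|] with [|u| <= K], hence at most [e / 2]. *)
have [|delta delta0 F_approx] := H_pre (e / 2 / K); first by rewrite divr_gt0.
have [||t [u [t0 t_lt vu]]] := v_dir (Num.min r 1) (Num.min tau (delta / K)).
- by rewrite lt_min r0 ltr01.
- by rewrite lt_min tau0 divr_gt0.
move: t_lt vu; rewrite !lt_min => /andP[t_tau t_delta] /andP[vu_r vu_1] Sz.
have uK : `|u| <= K.
  rewrite -(subKr (p, v) u) (le_trans (ler_normB _ _)) // lerD2l; exact: ltW.
have [w' Hw' ww'] := H_near u vu_r.
have FC : F ((pbar, xbar) + t *: u) `<=` C by exact: Sz.
have [||c Fc [_ [b b1 <-] cbE]] :=
    F_approx ((pbar, xbar) + t *: u) _ (y + t *: w').
- rewrite /closed_ball_ /= opprD addNKr normrN normrZ gtr0_norm //.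
  rewrite (le_trans (ler_wpM2l (ltW t0) uK)) // -ler_pdivlMr //; exact: ltW.
- exists y => //; exists (t *: w') => //.
  by rewrite [_ - _]addrC addKr H_homo //; exists w'.
move: b1 cbE; rewrite /closed_ball_ /= sub0r normrN => b1.
rewrite addrAC subrr add0r normrZ gtr0_norm // => cbE.
pose eta := e / 2 / K * `|u|.
have eta0 : 0 <= eta by rewrite mulr_ge0 // divr_ge0 // ltW.
have eta_e : eta <= e / 2 by rewrite /eta mulrAC ler_pdivrMr // ler_pM2l.
exists t, (w' - eta *: b); split=> //.
- rewrite opprB addrCA addrC (le_lt_trans (ler_normD _ _)) //.
  rewrite [ltRHS]splitr ltr_leD // normrZ ger0_norm //.
  by rewrite (le_trans _ eta_e) // ler_piMr.
- suff -> : y + t *: (w' - eta *: b) = c by exact: FC.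
  by rewrite scalerBr addrA -cbE scalerA /eta mulrCA addrK.
Qed.
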